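(* Let $a,s,d,n$ be positive integers with $\gcd(a,d)=1$, and let $S=\langle a,\ sa+d,\ sa+2d,\ \dots,\ sa+nd\rangle$ be the numerical semigroup generated by this generalized arithmetic sequence. Then $S$ is nearly Gorenstein if and only if $s=1$ or $a\equiv 2 \pmod n$.
   Context: A numerical semigroup is a submonoid $S$ of $\mathbb{N}=\{0,1,2,\dots\}$ with $\mathbb{N}\setminus S$ finite; $\langle\cdots\rangle$ denotes the set of all $\mathbb{N}$-linear combinations of the listed elements. $\mathrm{F}(S)=\max(\mathbb{Z}\setminus S)$ is the Frobenius number. Put $M(S)=S\setminus\{0\}$, $K(S)=\{z\in\mathbb{Z} : \mathrm{F}(S)-z\notin S\}$, and $S-K(S)=\{z\in\mathbb{Z} : z+K(S)\subseteq S\}$. $S$ is nearly Gorenstein if $M(S)\subseteq K(S)+(S-K(S))$.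
   Formalization: The case a = 1 (S = N) is excluded: there S is nearly Gorenstein for all s, d, n, so the claim fails, e.g. for a = 1, s = n = 2, where neither s = 1 nor a ≡ 2 (mod n) holds. *)

(* Defs.v *)
From mathcomp Require Import all_boot all_order all_algebra.
From mathcomp Require Import boolp classical_sets cardinality.
From mathcomp Require Import zify.

Set Implicit Arguments.
Unset Strict Implicit.
Unset Printing Implicit Defensive.

Import Order.TTheory GRing.Theory Num.Theory.

Local Open Scope classical_set_scope.
Local Open Scope ring_scope.

Record numerical_semigroup := NumericalSemigroup {
  ns_carrier : set nat;
  ns_zero : ns_carrier 0%N;
  ns_add : forall x y, ns_carrier x -> ns_carrier y -> ns_carrier (x + y)%N;
  ns_cofinite : finite_set (~` ns_carrier)
}.

Definition ns_int (S : numerical_semigroup) : set int :=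
  [set x%:Z | x in ns_carrier S].

Definition is_max (A : set int) (m : int) : Prop :=
  A m /\ forall z, A z -> z <= m.

(* The default value -1 of [xget] is never used: see [frobeniusP]. *)
Definition frobenius (S : numerical_semigroup) : int :=
  xget (-1) (is_max (~` ns_int S)).

Definition ns_M (S : numerical_semigroup) : set int := ns_int S `\ 0.

Definition ns_K (S : numerical_semigroup) : set int :=
  [set z | ~ ns_int S (frobenius S - z)].

Definition ns_SK (S : numerical_semigroup) : set int :=
  [set z | forall k, ns_K S k -> ns_int S (z + k)].

Definition nearly_gorenstein (S : numerical_semigroup) : Prop :=
  ns_M S `<=` [set x + y | x in ns_K S & y in ns_SK S].

Definition generated (g : seq nat) : set nat :=
  [set x | exists c : nat -> nat,
             x = (\sum_(i < size g) c i * nth 0 g i)%N].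

Definition gen_arith_seq (a s d n : nat) : seq nat :=
  (a :: [seq s * a + i * d | i <- iota 1 n])%N.

Lemma ns_int_nat (S : numerical_semigroup) (x : nat) :
  ns_int S x%:Z <-> ns_carrier S x.
Proof. by split=> [[y Sy [<-]]|Sx]; last exists x. Qed.

Lemma frobeniusP (S : numerical_semigroup) :
  is_max (~` ns_int S) (frobenius S).
Proof.
suff [m Hm] : exists m, is_max (~` ns_int S) m.
  by rewrite /frobenius; case: xgetP => [y _ //|/(_ m)].
have [N HN] : exists N, forall x, ~ ns_carrier S x -> (x < N)%N.
  have /finite_seqP[r Er] := ns_cofinite S.
  exists (\max_(x <- r) x).+1 => x Sx; rewrite ltnS.
  apply: (@leq_bigmax_seq _ r xpredT id) => //.
  by have : [set` r] x by rewrite -Er.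
elim: N HN => [|N IHN] HN.
  exists (-1); split=> [[x _] //|[x|x] Sz]; last by lia.
  have /HN : ~ ns_carrier S x by move=> Sx; apply: Sz; apply/ns_int_nat.
  by [].
have [SN|SN] := pselect (ns_carrier S N).
  apply: IHN => x Sx; have := HN x Sx; rewrite ltnS leq_eqVlt.
  by case/orP=> // /eqP xN; rewrite xN in Sx.
exists N%:Z; split=> [/ns_int_nat //|[x|x] Sz]; last by lia.
have /HN : ~ ns_carrier S x by move=> Sx; apply: Sz; apply/ns_int_nat.
by rewrite ltnS lez_nat.
Qed.

Lemma generated0 (g : seq nat) : generated g 0%N.
Proof. by exists (fun=> 0%N); rewrite big1. Qed.

Lemma generatedD (g : seq nat) (x y : nat) :
  generated g x -> generated g y -> generated g (x + y)%N.
Proof.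
move=> [c ->] [e ->]; exists (fun i => c i + e i)%N.
by rewrite -big_split; apply: eq_bigr => i _; rewrite mulnDl.
Qed.

Lemma generatedM (g : seq nat) (k x : nat) :
  generated g x -> generated g (k * x)%N.
Proof.
move=> [c ->]; exists (fun i => k * c i)%N.
by rewrite big_distrr; apply: eq_bigr => i _; rewrite /= mulnA.
Qed.

Lemma generated_mem (g : seq nat) (x : nat) : x \in g -> generated g x.
Proof.
move=> xg; have ig : (index x g < size g)%N by rewrite index_mem.
exists (fun i => nat_of_bool (i == index x g)).
rewrite (bigD1 (Ordinal ig)) //= eqxx mul1n nth_index // big1 ?addn0 // => i.
by rewrite -val_eqE /= => /negbTE ->.
Qed.

Lemma generated_cofinite (g : seq nat) (p q : nat) :
  (0 < p)%N -> coprime p q -> p \in g -> q \in g ->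
  finite_set (~` generated g).
Proof.
move=> p0 pq pg qg.
apply: (@sub_finite_set _ _ `I_(p * q)); last exact: finite_II.
move=> x /= Sx; rewrite ltnNge; apply/negP => pqx; apply: Sx.
have qy : (q %| chinese p q x 0)%N.
  by rewrite /dvdn chinese_modr // mod0n.
pose v := ((chinese p q x 0 %/ q) %% p)%N.
have vx : (v * q = x %[mod p])%N by rewrite modnMml divnK // chinese_modl.
have vqx : (v * q <= x)%N.
  by apply: leq_trans pqx; rewrite leq_mul2r ltnW ?orbT // ltn_mod.
have /dvdnP[u xE] : (p %| x - v * q)%N by rewrite -eqn_mod_dvd // vx.
rewrite -(subnK vqx) xE.
by apply: generatedD; apply: generatedM; apply: generated_mem.
Qed.

Lemma gen_arith_seq_cofinite (a s d n : nat) :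
  (0 < a)%N -> (0 < n)%N -> coprime a d ->
  finite_set (~` generated (gen_arith_seq a s d n)).
Proof.
move=> a0 n0 ad; apply: (@generated_cofinite _ a (s * a + 1 * d)) => //.
- by rewrite mul1n /coprime gcdnMDl.
- by rewrite mem_head.
- by rewrite inE; apply/orP; right; apply/mapP; exists 1%N; rewrite ?mem_iota.
Qed.

Definition gen_arith_semigroup (a s d n : nat)
    (a0 : (0 < a)%N) (n0 : (0 < n)%N) (ad : coprime a d) :
    numerical_semigroup :=
  NumericalSemigroup (generated0 (gen_arith_seq a s d n))
    (@generatedD (gen_arith_seq a s d n))
    (gen_arith_seq_cofinite s a0 n0 ad).

Arguments gen_arith_semigroup : clear implicits.

(* S = N, i.e. a = 1, is nearly Gorenstein whatever s and n are, so the
   criterion [s = 1 \/ a = 2 %[mod n]] can only hold for S <> N: it fails for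
   (a, s, n) = (1, 2, 2). *)
Lemma nearly_gorenstein_gen1 (s d n : nat) (a0 : (0 < 1)%N) (n0 : (0 < n)%N)
    (ad : coprime 1 d) :
  nearly_gorenstein (gen_arith_semigroup 1 s d n a0 n0 ad).
Proof.
set S := gen_arith_semigroup _ _ _ _ _ _ _.
have ST x : ns_carrier S x.
  by rewrite -[x]muln1; apply: generatedM; apply: generated_mem; apply: mem_head.
have intP z : ns_int S z <-> 0 <= z.
  by split=> [[x _ <-] //|]; case: z => // x _; apply/ns_int_nat.
have FS : frobenius S = -1.
  have [F1 F2] := frobeniusP S.
  have := F2 (-1) (fun h => ltac:(by move/intP: h)).
  have : ~ 0 <= frobenius S by move/intP.
  by lia.
have KP z : ns_K S z <-> 0 <= z.
  rewrite /ns_K /= FS; split=> [h|z0 /intP]; last by lia.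
  by rewrite leNgt; apply/negP => z0; apply: h; apply/intP; lia.
move=> z [/intP z0 _]; exists z; first exact/KP.
exists 0; last by rewrite addr0.
by move=> k /KP k0; apply/intP; rewrite add0r.
Qed.

(* Main.v *)
(* Every integer is uniquely q a + i d with 0 <= i < a, and it lies in S iff
   s ceil(i/n) <= q.  Hence, writing a - 2 = n (c - 1) + r with 0 <= r < n, one
   has F(S) = (s c - 1) a + (a - 1) d and K(S) is the union of the t d + S for
   0 <= t <= r.  If r = 0 then K(S) = S.  If s = 1 then each generator a + j d
   is t d + (a + (j - t) d) with t = min(j, r), where the second summand is in
   S - K(S).  If s >= 2 and r >= 1, then a in K(S) + (S - K(S)) would force
   a + d or a - d to be in S. *)
Require Import Defs.
From mathcomp Require Import all_boot.
From mathcomp Require Import all_order all_algebra.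
From mathcomp Require Import boolp classical_sets.
From mathcomp Require Import zify ring.

Set Implicit Arguments.
Unset Strict Implicit.
Unset Printing Implicit Defensive.

Import Order.TTheory GRing.Theory Num.Theory.

(** * Integers in terms of [a] and [d] *)

Lemma is_max_uniq (A : set int) (x y : int) : is_max A x -> is_max A y -> x = y.
Proof. by move=> [Ax xmax] [Ay ymax]; apply: le_anti; rewrite xmax ?ymax. Qed.

Lemma ns_intD (S : numerical_semigroup) (x y : int) :
  ns_int S x -> ns_int S y -> ns_int S (x + y)%R.
Proof.
move=> [k Sk <-] [l Sl <-]; rewrite -PoszD.
by apply/ns_int_nat; apply: ns_add.
Qed.

(** Multiply a Bezout relation by [z]; the coefficient of [d] is reduced modulo [a] to give [i], and
    its quotient is moved into [q]. *)
Lemma int_canonical (a d : nat) (z : int) : 0 < a -> coprime a d ->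
  exists (q : int) (i : nat), i < a /\ z = (q * a%:Z + (i * d)%:Z)%R.
Proof.
move=> a0 ad.
have [[u v] /= uv] := coprimezP a%:Z d%:Z ad.
have am : ((z * v)%R %% a)%Z = `|((z * v)%R %% a)%Z|%N.
  by rewrite gez0_abs // modz_ge0; lia.
have va := divz_eq (z * v)%R a%:Z.
exists (z * u + ((z * v) %/ a)%Z * d)%R, `|((z * v)%R %% a)%Z|%N; split.
  by rewrite -ltz_nat -am ltz_pmod.
rewrite PoszM -am -[LHS]mulr1 -uv.
have -> : (z * (u * a%:Z + v * d%:Z) = z * u * a%:Z + z * v * d%:Z)%R by ring.
rewrite [in LHS]va; ring.
Qed.

(** * Membership in S *)

Section GenArith.

Variables (a s d n : nat).
Hypotheses (a0 : 0 < a) (n0 : 0 < n) (ad : coprime a d).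

Let S := gen_arith_semigroup a s d n a0 n0 ad.
Local Notation g := (gen_arith_seq a s d n).

(** [u] counts the copies of [a], [C] the other generators, and [j] adds up the indices of the
    latter. *)
Lemma generated_gen_arithP (x : nat) : generated g x <->
  exists u C j : nat, j <= n * C /\ x = (u + s * C) * a + j * d.
Proof.
split=> [[c ->]|[u [C [j [jC ->]]]]].
  exists (c 0), (\sum_(i < n) c i.+1), (\sum_(i < n) c i.+1 * i.+1); split.
    rewrite big_distrr; apply: leq_sum => i _ /=.
    by rewrite mulnC leq_mul2r ltn_ord orbT.
  rewrite /= size_map size_iota big_ord_recl /= mulnDl -addnA; congr addn.
  rewrite mulnAC big_distrr big_distrl -big_split /=; apply: eq_bigr => i _.
  rewrite (nth_map 0) ?size_iota ?nth_iota ?add0n ?ltn_ord // add1n; ring.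
have Sa : generated g a by apply: generated_mem; rewrite mem_head.
(* Index 0 is allowed, since [s * a] is a multiple of [a]; so [C] summands can be used even when [j]
   is small. *)
have Sgen i : i <= n -> generated g (s * a + i * d).
  case: i => [|i] ni; first by rewrite addn0; apply: generatedM.
  apply: generated_mem; rewrite inE; apply/orP; right; apply/mapP.
  by exists i.+1; rewrite // mem_iota.
elim: C j jC => [|C IHC] j jC.
  have -> : j = 0 by lia.
  by rewrite muln0 !addn0; apply: generatedM.
(* Greedy choice: split off the largest index available, so that the rest fits into [n * C]. *)
have -> : (u + s * C.+1) * a + j * d =
    (s * a + minn j n * d) + ((u + s * C) * a + (j - minn j n) * d).
  rewrite -{1}(subnKC (geq_minl j n)); ring.
by apply: generatedD; [apply: Sgen; lia | apply: IHC; lia].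
Qed.

Local Open Scope ring_scope.

Lemma ns_intP (z : int) : ns_int S z <->
  exists u C j : nat, (j <= n * C)%N /\ z = (u + s * C)%:Z * a%:Z + (j * d)%:Z.
Proof.
split=> [[x /generated_gen_arithP [u [C [j [jC ->]]]] <-]|].
  by exists u, C, j; split=> //; lia.
move=> [u [C [j [jC ->]]]]; rewrite -PoszM -PoszD; apply/ns_int_nat.
by apply/generated_gen_arithP; exists u, C, j.
Qed.

Lemma ns_int_canonical (q : int) (i : nat) : (i < a)%N ->
  ns_int S (q * a%:Z + (i * d)%:Z) <->
  exists C : nat, (i <= n * C)%N /\ (s * C)%:Z <= q.
Proof.
move=> ia; split=> [/ns_intP[u [C [j [jC E]]]]|[C [iC qC]]]; last first.
  apply/ns_intP; exists `|q - (s * C)%:Z|%N, C, i; split=> //.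
  by congr (_ * _ + _); lia.
(* The same [C] works: by coprimality [j = i + k * a], where [k >= 0] because [j >= 0] and [i < a];
   hence [i <= j] and [q = u + s * C + k * d >= s * C]. *)
exists C.
have E' : (j%:Z - i%:Z) * d%:Z = (q - (u + s * C)%:Z) * a%:Z.
  by move: E; rewrite !PoszM !mulrBl => E; lia.
have /dvdzP[k kE] : (a %| j%:Z - i%:Z)%Z.
  by rewrite -(@Gauss_dvdzl _ _ d%:Z) // E' dvdz_mull.
have k0 : 0 <= k by nia.
have qE : q = (u + s * C)%:Z + k * d%:Z.
  have aN0 : a%:Z != 0 by lia.
  by apply: (mulIf aN0); move: E'; rewrite kE; lia.
by split; nia.
Qed.

End GenArith.

(** * Frobenius number and canonical ideal *)

Section NearlyGorenstein.

Local Open Scope ring_scope.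

Variables (a s d n : nat).
Hypotheses (a0 : (0 < a)%N) (n0 : (0 < n)%N) (ad : coprime a d).
Hypotheses (s0 : (0 < s)%N) (a1 : (1 < a)%N).

Let S := gen_arith_semigroup a s d n a0 n0 ad.
(** This is the ceiling of [(a - 1) / n]. *)
Let c := ((a - 2) %/ n).+1.
Let r := ((a - 2) %% n)%N.

Let aE : a = (n * (c - 1) + r + 2)%N.
Proof. rewrite /c /r subn1 /= mulnC -divn_eq; lia. Qed.

Let rn : (r < n)%N.
Proof. by rewrite ltn_mod. Qed.

Let F : int := ((s * c)%:Z - 1) * a%:Z + ((a - 1) * d)%:Z.

(** As [n * (c - 1) < a - 1 <= n * c], index [a - 1] requires [q >= s * c], and such a [q] suffices
    for every index. *)
Lemma frobenius_gen_arith : frobenius S = F.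
Proof.
apply: is_max_uniq (frobeniusP S) _; split.
  move/ns_int_canonical => /(_ ltac:(lia)) [C [aC qC]].
  have Cc : (C < c)%N by nia.
  nia.
move=> z Sz; rewrite leNgt; apply/negP => Fz; apply: Sz.
have [q [i [ia zE]]] := int_canonical z a0 ad.
have id : (i * d <= (a - 1) * d)%N by rewrite leq_mul2r; lia.
rewrite zE; apply/ns_int_canonical => //; exists c; split; first nia.
have : ((s * c)%:Z - 1) * a%:Z < q * a%:Z by move: Fz; rewrite zE /F; lia.
by rewrite ltr_pM2r; lia.
Qed.

Lemma ns_K_gen_arithP (z : int) : ns_K S z <->
  exists2 t : nat, (t <= r)%N & ns_int S (z - (t * d)%:Z).
Proof.
rewrite /ns_K /= frobenius_gen_arith; split=> [Kz|[t tr Sz] Fz]; last first.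
  have := ns_intD Sz Fz.
  have -> : z - (t * d)%:Z + (F - z) =
      ((s * c)%:Z - 1) * a%:Z + ((a - 1 - t) * d)%:Z.
    rewrite /F -[in LHS](subnK (_ : t <= a - 1)%N); last lia.
    by rewrite mulnDl PoszD; ring.
  move/ns_int_canonical => /(_ ltac:(lia)) [C [aC qC]].
  (* [t <= r] leaves [a - 1 - t > n * (c - 1)], which is too large for any [C < c]. *)
  have Cc : (C < c)%N by nia.
  nia.
have [q [i [ia zE]]] := int_canonical z a0 ad.
(* No [C] can witness that [F - z], of index [a - 1 - i], lies in S. *)
have NK C : (a - 1 - i <= n * C)%N -> (s * C)%:Z <= (s * c)%:Z - 1 - q -> False.
  move=> iC qC; apply: Kz.
  have -> : F - z = ((s * c)%:Z - 1 - q) * a%:Z + ((a - 1 - i) * d)%:Z.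
    rewrite zE /F -(subnK (_ : i <= a - 1)%N); last lia.
    by rewrite addnK mulnDl PoszD; ring.
  by apply/ns_int_canonical; [lia | exists C].
have [ir|ri] := leqP i r.
  exists i => //.
  have -> : z - (i * d)%:Z = q * a%:Z + (0 * d)%:Z by rewrite zE; lia.
  apply/ns_int_canonical; [lia | exists 0%N; split=> //].
  rewrite muln0 leNgt; apply/negP => q0; apply: (NK c); first nia.
  lia.
exists r => //.
have -> : z - (r * d)%:Z = q * a%:Z + ((i - r) * d)%:Z.
  by rewrite zE -{1}(subnK (ltnW ri)) mulnDl PoszD; ring.
apply/ns_int_canonical; first lia.
(* The ceiling of [(i - r) / n]. If it failed, [c - C] would contradict [NK], as [a - 1 - i = n * (c
   - 1) + 1 - (i - r) <= n * (c - C)]. *)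
pose C := ((i - r).-1 %/ n).+1.
have Clb : (n * C.-1 <= (i - r).-1)%N by rewrite mulnC leq_divM.
have Cub : (i - r <= n * C)%N.
  by have := ltn_ceil (i - r).-1 n0; rewrite mulnC /C; lia.
have Cc : (C <= c)%N by nia.
exists C; split=> //; rewrite leNgt; apply/negP => qC.
apply: (NK (c - C)%N); first nia.
by rewrite mulnBr -subzn ?leq_mul2l ?Cc ?orbT //; lia.
Qed.

Lemma ns_K_shift (t : nat) : (t <= r)%N -> ns_K S (t * d)%:Z.
Proof.
move=> tr; apply/ns_K_gen_arithP; exists t => //.
by rewrite subrr; apply/(ns_int_nat S 0)/ns_zero.
Qed.

Lemma ns_SK_gen_arith (z : int) :
  (forall t : nat, (t <= r)%N -> ns_int S (z + (t * d)%:Z)) -> ns_SK S z.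
Proof.
move=> Sz k /ns_K_gen_arithP[t tr Sk].
by have := ns_intD (Sz t tr) Sk; rewrite addrACA subrr addr0.
Qed.

(** * The two directions of the criterion *)

Lemma nearly_gorenstein_rem0 : r = 0%N -> nearly_gorenstein S.
Proof.
move=> r0 z [Sz _]; exists 0; first exact: (@ns_K_shift 0).
exists z; last by rewrite add0r.
by apply: ns_SK_gen_arith => t; rewrite r0 leqn0 => /eqP->; rewrite addr0.
Qed.

Lemma nearly_gorenstein_s1 : s = 1%N -> nearly_gorenstein S.
Proof.
move=> s1 z [/ns_intP[u [C [j [jC zE]]]] z0].
have Sz u' C' j' : (j' <= n * C')%N ->
    ns_int S ((u' + C')%:Z * a%:Z + (j' * d)%:Z).
  by move=> jC'; apply/ns_intP; exists u', C', j'; rewrite s1 mul1n.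
rewrite s1 mul1n in zE.
(* After this removal any [t <= r] can be added: the new index is at most [j] if [j >= r], and
   otherwise it is [t < n], which fits once [C >= 1]. *)
exists (minn j r * d)%:Z; first by apply: ns_K_shift; lia.
exists (z - (minn j r * d)%:Z); last by ring.
apply: ns_SK_gen_arith => t tr.
have -> : z - (minn j r * d)%:Z + (t * d)%:Z =
    (u + C)%:Z * a%:Z + ((j - minn j r + t) * d)%:Z.
  rewrite zE -{1}(subnK (geq_minl j r)) !mulnDl !PoszD; ring.
case: C jC zE => [|C] jC zE; last by apply: Sz; nia.
(* Here [z] is a positive multiple of [a]; as [s = 1], one copy of [a] serves as the generator of
   index 0, giving [C = 1]. *)
have j0 : j = 0%N by lia.
rewrite j0 in zE *; case: u zE => [|u] zE; first by case: z0; rewrite /= zE; lia.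
have -> : (u.+1 + 0)%N = (u + 1)%N by lia.
apply: Sz; lia.
Qed.

Lemma nearly_gorenstein_s1_or_rem0 :
  (0 < d)%N -> nearly_gorenstein S -> s = 1%N \/ r = 0%N.
Proof.
move=> d0 NG; have [->|s1] := eqVneq s 1%N; first by left.
have [->|r0] := eqVneq r 0%N; first by right.
have s2 : (1 < s)%N by lia.
have Ma : ns_M S a%:Z.
  split; last by case; lia.
  by apply/ns_int_nat/generated_mem; rewrite mem_head.
have [x /ns_K_gen_arithP[t tr Sx] [y SKy xyE]] := NG _ Ma.
have Sat t' : (t' <= r)%N -> ns_int S (a%:Z - (t * d)%:Z + (t' * d)%:Z).
  move=> t'r; have -> : a%:Z - (t * d)%:Z + (t' * d)%:Z =
    (x - (t * d)%:Z) + (y + (t' * d)%:Z) by rewrite -xyE; ring.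
  by apply: ns_intD => //; apply/SKy/ns_K_shift.
have [tltr|rt] := ltnP t r.
  (* This puts [a + d] in S; index 1 forces [C >= 1], so [s <= 1]. *)
  have := Sat t.+1 tltr.
  have -> : a%:Z - (t * d)%:Z + (t.+1 * d)%:Z = 1 * a%:Z + (1 * d)%:Z by lia.
  move/ns_int_canonical => /(_ a1) [[|C] [C1 sC]]; first by rewrite muln0 in C1.
  exfalso; nia.
have tE : t = r by lia.
(* This puts [a - d] in S; its canonical index is [a - 1 > 0], but its quotient [1 - d <= 0] is
   below [s]. *)
have := Sat r.-1 (leq_pred r).
have -> : a%:Z - (t * d)%:Z + (r.-1 * d)%:Z =
    (1 - d%:Z) * a%:Z + ((a - 1) * d)%:Z.
  rewrite tE -{1}(prednK (_ : 0 < r)%N) ?lt0n // mulSn mulnBl -subzn; last nia.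
  by rewrite !PoszD !PoszM; ring.
move/ns_int_canonical => /(_ ltac:(lia)) [[|C] [aC qC]]; first by lia.
exfalso; nia.
Qed.

End NearlyGorenstein.

Theorem proposition3p4 (a s d n : nat)
    (a0 : 0 < a) (s0 : 0 < s) (d0 : 0 < d) (n0 : 0 < n)
    (ad : coprime a d) (a1 : a <> 1) :
  nearly_gorenstein (gen_arith_semigroup a s d n a0 n0 ad) <->
  (s = 1 \/ a = 2 %[mod n]).
Proof.
have a2 : 1 < a by lia.
have a2E : a = 2 %[mod n] <-> (a - 2) %% n = 0.
  split=> [/eqP|/eqP a2n]; first by rewrite eqn_mod_dvd // => /eqP.
  by apply/eqP; rewrite eqn_mod_dvd.
split=> [NG|[s1|/a2E r0]].
- by case: (nearly_gorenstein_s1_or_rem0 s0 a2 d0 NG) => [|/a2E]; [left | right].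
- exact: nearly_gorenstein_s1.
- exact: nearly_gorenstein_rem0.
Qed.
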